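(* Let $s\in\mathbb{C}$ with $\Re(s)>1$ and let $z$ be a primitive $q$-th root of unity with $q\ge 1$. Let $k\ge 2$ be an integer of the form $k=bq+1$ for some positive integer $b$. Then $$\mathrm{Li}_z(s)\left(1-k^{\delta_q-s}\right)=\sum_{m\ge 1}\frac{P_m(s)\,\mathrm{Li}_z(s+m)}{k^{s+m}}\sum_{h=1}^{k-1}z^{-h}h^m .$$
   Context: For a root of unity $z$ and $\Re(s)>1$, $\mathrm{Li}_z(s):=\sum_{n\ge1}\frac{z^n}{n^s}$. For $m\ge 0$, $P_0(s)=1$ and $P_m(s)=\frac{s(s+1)\cdots(s+m-1)}{m!}$ for $m\ge1$. $\delta_q$ denotes the integral part of $1/q$, i.e. $\delta_1=1$ and $\delta_q=0$ for $q\ge 2$. *)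

(* Defs.v *)
From Stdlib Require Import Reals Factorial.
From Coquelicot Require Import Coquelicot.

Open Scope C_scope.

Definition Cexp (w : C) : C :=
  (exp (Re w) * cos (Im w), exp (Re w) * sin (Im w))%R.

(** [Rcpow x w] is [x ^ w] for real [x > 0] (real logarithm); it is only
    meaningful for positive [x]. *)
Definition Rcpow (x : R) (w : C) : C := Cexp (RtoC (ln x) * w).

(** Total sum operator: the limit of the partial sums when it exists, a junk
    value otherwise. *)
Definition CSeries (a : nat -> C) : C :=
  @iota C_CompleteNormedModule (fun l => is_series a l).

Lemma CSeries_unique (a : nat -> C) (l : C) : is_series a l -> CSeries a = l.
Proof.
intros Ha.
exact (@iota_filterlim_locally _ C_CompleteNormedModule _ eventually _
         (sum_n a) l Ha).
Qed.

(** The series start at [n = 1]: the term of index [n] is the one of the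
    integer [S n]. *)
Definition Li (z s : C) : C :=
  CSeries (fun n : nat => z ^ S n / Rcpow (INR (S n)) s).

Fixpoint rising (s : C) (m : nat) : C :=
  match m with
  | O => 1
  | S m' => rising s m' * (s + RtoC (INR m'))
  end.

Definition P (m : nat) (s : C) : C := rising s m / RtoC (INR (fact m)).

Definition primitive_root (q : nat) (z : C) : Prop :=
  (1 <= q)%nat /\ z ^ q = 1 /\
  forall j : nat, (0 < j < q)%nat -> z ^ j <> 1.

(** Integer quotient, i.e. the integral part of [1 / q]. *)
Definition delta (q : nat) : nat := Nat.div 1 q.

(* Main.v *)
Require Import Defs.
From Stdlib Require Import Reals Lra Lia.
From Coquelicot Require Import Coquelicot.

Open Scope C_scope.

(** The integers are sorted by their position [h], with [0 <= h < k], below the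
    next multiple [k * j] of [k]. Because [k] is [1] modulo [q], the term of
    [k * j - h] in [Li z s] is
    [z ^ j * z ^ (- h) * (k * j) ^ (- s) * (1 - h / (k * j)) ^ (- s)],
    and the binomial theorem [is_series_binomial] expands the last factor in
    powers of [h / (k * j)] with coefficients [P m s].

    The part [m = 0] of the expansion, together with the terms [h = 0],
    contributes [(1 + sum z ^ (- h)) * k ^ (- s) * Li z s]. The sum over [h]
    covers [b] full periods of the powers of [z], so the first factor is [k] when
    [q = 1] and [1] otherwise, that is [k ^ delta q]
    ([one_plus_sum_inv_pow]); moving this part to the left gives the factor
    [1 - k ^ (delta q - s)] ([is_series_Li_residues]).

    For [m >= 1], summing over [j] first gives the multiple of
    [Li z (s + m)] in the theorem. What remains is the exchange of the sums over
    [j] and [m]. The term of index [(j, m)] is bounded by a product: the power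
    [j ^ (- Re s)], summable as [Re s > 1], times a quantity depending on [m]
    and dominated by [|P m s| * sum (h / k) ^ m], summable as [h < k]. For such
    products the exchange is an estimate of tails ([is_series_exchange]). *)

(** * Complex exponential and complex powers of positive reals *)

Lemma Cexp_plus (a b : C) : Cexp (a + b) = Cexp a * Cexp b.
Proof.
unfold Cexp.
rewrite re_plus, im_plus, exp_plus, cos_plus, sin_plus.
unfold Cmult; simpl; f_equal; ring.
Qed.

Lemma Cexp_0 : Cexp 0 = 1.
Proof.
unfold Cexp; simpl; rewrite exp_0, cos_0, sin_0.
apply injective_projections; simpl; ring.
Qed.

Lemma Cmod_Cexp (w : C) : Cmod (Cexp w) = exp (Re w).
Proof.
unfold Cexp, Cmod; simpl fst; simpl snd.
replace (_ ^ 2 + _ ^ 2)%R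
  with (Rsqr (exp (Re w)) * (Rsqr (sin (Im w)) + Rsqr (cos (Im w))))%R
  by (unfold Rsqr; ring).
rewrite sin2_cos2, Rmult_1_r.
apply sqrt_Rsqr, Rlt_le, exp_pos.
Qed.

Lemma Cmod_Rcpow (x : R) (w : C) : Cmod (Rcpow x w) = Rpower x (Re w).
Proof.
unfold Rcpow, Rpower; rewrite Cmod_Cexp.
f_equal; unfold Re; simpl; ring.
Qed.

Lemma Rcpow_nonzero (x : R) (w : C) : Rcpow x w <> 0.
Proof.
intros H; apply (f_equal Cmod) in H; revert H.
rewrite Cmod_Rcpow, Cmod_0.
apply Rgt_not_eq, exp_pos.
Qed.

Lemma Rcpow_plus (x : R) (v w : C) : Rcpow x (v + w) = Rcpow x v * Rcpow x w.
Proof. unfold Rcpow; rewrite <- Cexp_plus; f_equal; ring. Qed.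

Lemma Rcpow_minus (x : R) (v w : C) : Rcpow x (v - w) = Rcpow x v / Rcpow x w.
Proof.
assert (H : Rcpow x v = Rcpow x (v - w) * Rcpow x w)
  by (rewrite <- Rcpow_plus; f_equal; ring).
rewrite H; field; apply Rcpow_nonzero.
Qed.

Lemma Rcpow_mult_base (x y : R) (w : C) :
  (0 < x)%R -> (0 < y)%R -> Rcpow (x * y) w = Rcpow x w * Rcpow y w.
Proof.
intros hx hy; unfold Rcpow.
rewrite ln_mult, RtoC_plus, <- Cexp_plus by assumption.
f_equal; ring.
Qed.

Lemma Rcpow_INR (x : R) (m : nat) :
  (0 < x)%R -> Rcpow x (RtoC (INR m)) = RtoC x ^ m.
Proof.
intros hx; induction m as [|m IH].
- simpl; unfold Rcpow; rewrite Cmult_0_r; apply Cexp_0.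
- rewrite S_INR, RtoC_plus, Rcpow_plus, IH, Cpow_S, Cmult_comm; f_equal.
  unfold Rcpow; rewrite Cmult_1_r; unfold Cexp; simpl.
  rewrite cos_0, sin_0, exp_ln by assumption.
  apply injective_projections; simpl; ring.
Qed.

(** * Series in normed modules *)

Lemma is_series_sum_n_m {K : AbsRing} {V : NormedModule K}
    (a : nat -> nat -> V) (l : nat -> V) (n m : nat) :
  (forall h, (n <= h <= m)%nat -> is_series (a h) (l h)) ->
  is_series (fun i => sum_n_m (fun h => a h i) n m) (sum_n_m l n m).
Proof.
assert (zero_case : forall n m, (m < n)%nat ->
  is_series (fun i => sum_n_m (fun h => a h i) n m) (sum_n_m l n m)).
{ intros n' m' hnm; rewrite sum_n_m_zero by assumption.
  apply is_series_ext with (fun _ => zero).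
  { intros i; now rewrite sum_n_m_zero. }
  apply filterlim_ext with (fun _ => zero).
  - intros i; symmetry; apply sum_n_m_const_zero.
  - apply filterlim_const. }
induction m as [|m IH]; intros H.
- destruct n as [|n]; [|apply zero_case; lia].
  rewrite sum_n_n; apply is_series_ext with (a 0%nat); [|apply H; lia].
  intros i; now rewrite sum_n_n.
- destruct (Nat.le_gt_cases n (S m)) as [hn|hn]; [|now apply zero_case].
  rewrite sum_n_Sm by assumption.
  apply is_series_ext
    with (fun i => plus (sum_n_m (fun h => a h i) n m) (a (S m) i)).
  { intros i; now rewrite sum_n_Sm. }
  apply is_series_plus; [apply IH; intros; apply H; lia | apply H; lia].
Qed.

Lemma norm_is_series_le {K : AbsRing} {V : NormedModule K}
    (a : nat -> V) (b : nat -> R) (l : V) (M : R) :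
  (forall n, norm (a n) <= b n)%R -> is_series a l -> is_series b M ->
  (norm l <= M)%R.
Proof.
intros hab hl hM.
apply (@filterlim_le nat eventually _
         (fun n => norm (sum_n a n)) (sum_n b) (norm l) M).
- exists 0%nat; intros n _.
  eapply Rle_trans; [apply norm_sum_n_m|].
  now apply sum_n_m_le.
- apply filterlim_comp with (locally l); [exact hl | apply filterlim_norm].
- exact hM.
Qed.

Lemma is_series_norm_lim {K : AbsRing} {V : NormedModule K}
    (a : nat -> V) (l : V) (e : nat -> R) :
  (forall n, norm (minus l (sum_n a n)) <= e n)%R -> is_lim_seq e 0 ->
  is_series a l.
Proof.
intros he lim0.
apply (filterlim_locally (F := eventually)); intros eps.
apply is_lim_seq_spec in lim0; destruct (lim0 eps) as [N hN].
exists N; intros n hn.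
apply (norm_compat1 (V := V)).
rewrite <- norm_opp, opp_minus.
eapply Rle_lt_trans; [apply he|].
specialize (hN n hn); rewrite Rminus_0_r in hN.
eapply Rle_lt_trans; [apply Rle_abs | exact hN].
Qed.

Lemma is_series_tail {K : AbsRing} {V : NormedModule K}
    (a : nat -> V) (l : V) (n : nat) :
  is_series a l -> is_series (fun i => a (S n + i)%nat) (minus l (sum_n a n)).
Proof.
intros ha.
apply (is_series_incr_n a (S n)); [lia|].
change (Init.Nat.pred (S n)) with n.
refine (eq_ind_r (is_series a) ha _).
unfold minus; rewrite <- plus_assoc.
exact (eq_trans
  (f_equal (plus l) (@plus_opp_l (NormedModule.AbelianGroup K V) (sum_n a n)))
  (plus_zero_r l)).
Qed.

(** Domination by a product [u j * v m] makes the exchange elementary: after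
    the columns of index at most [n] are removed, what is
    left of row [j] has norm at most [u j] times the tail of the series of [v],
    so the partial sums of [c] miss [l] by at most the sum of [u] times that
    tail. *)
Lemma is_series_exchange {K : AbsRing} {V : NormedModule K}
    (a : nat -> nat -> V) (u v : nat -> R) (A c : nat -> V) (l : V) :
  (forall j m, norm (a j m) <= u j * v m)%R ->
  ex_series u -> ex_series v ->
  (forall j, is_series (a j) (A j)) ->
  (forall m, is_series (fun j => a j m) (c m)) ->
  is_series A l -> is_series c l.
Proof.
intros hbound [U hU] [W hW] hrow hcol hA.
apply is_series_norm_lim with (fun n => U * (W - sum_n v n))%R.
- intros n.
  apply norm_is_series_le
    with (fun j => minus (A j) (sum_n (a j) n))
         (fun j => u j * (W - sum_n v n))%R.
  + intros j.
    apply norm_is_series_le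
      with (fun i => a j (S n + i)%nat) (fun i => u j * v (S n + i)%nat)%R.
    * intros i; apply hbound.
    * now apply is_series_tail.
    * exact (is_series_scal_l (u j) _ _ (is_series_tail v W n hW)).
  + apply is_series_minus; [exact hA|].
    apply (is_series_sum_n_m (fun m j => a j m)); intros m _; apply hcol.
  + apply (is_series_scal_r (W - sum_n v n) u U hU).
- replace (Finite 0) with (Rbar_mult U 0) by (simpl; f_equal; ring).
  apply is_lim_seq_scal_l.
  replace (Finite 0) with (Finite (W - W)) by (f_equal; ring).
  apply is_lim_seq_minus'; [apply is_lim_seq_const | exact hW].
Qed.

Lemma sum_n_add {G : AbelianMonoid} (t : nat -> G) (n p : nat) :
  sum_n t (n + S p) = plus (sum_n t n) (sum_n (fun i => t (S n + i)%nat) p).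
Proof.
induction p as [|p IH].
- rewrite sum_O, Nat.add_1_r, sum_Sn; do 2 f_equal; lia.
- rewrite sum_Sn, plus_assoc, <- IH.
  replace (n + S (S p))%nat with (S (n + S p)) by lia.
  rewrite sum_Sn; do 2 f_equal.
Qed.

Lemma sum_n_rev {G : AbelianMonoid} (t : nat -> G) (p : nat) :
  sum_n (fun h => t (p - h)%nat) p = sum_n t p.
Proof.
induction p as [|p IH].
- now rewrite !sum_O.
- unfold sum_n at 1; rewrite sum_Sn_m by lia.
  rewrite <- sum_n_m_S; fold (sum_n (fun h => t (S p - S h)%nat) p); simpl.
  rewrite IH, sum_Sn; apply plus_comm.
Qed.

(** The partial sums of the grouped series are a subsequence of those of [t].
    Each block is listed backwards because the block that ends at the multiple
    [(n + 1) * S p] is later described by the distance [h] to that multiple. *)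
Lemma is_series_blocks {K : AbsRing} {V : NormedModule K}
    (t : nat -> V) (p : nat) (l : V) :
  is_series t l ->
  is_series (fun n => sum_n (fun h => t (n * S p + (p - h))%nat) p) l.
Proof.
intros ht.
apply filterlim_ext with (fun n => sum_n t (n * S p + p)).
- induction x as [|n IH].
  + rewrite sum_O; simpl; symmetry; apply (sum_n_rev t).
  + rewrite sum_Sn, <- IH.
    replace (S n * S p + p)%nat with (n * S p + p + S p)%nat by lia.
    rewrite sum_n_add; f_equal.
    rewrite <- (sum_n_rev (fun i => t (S (n * S p + p) + i)%nat)).
    apply sum_n_ext; intros h; f_equal; lia.
- apply filterlim_comp with (2 := ht).
  intros P [N hN]; exists N; intros n hn; apply hN; nia.
Qed.

(** * Convergence of the Dirichlet series *)

(** Comparison with the telescoping series of [n ^ (1 - sigma)]: the inequality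
    [1 + u <= exp u], used twice, gives
    [(sigma - 1) * (n + 1) ^ (- sigma) <= n ^ (1 - sigma) - (n + 1) ^ (1 - sigma)]. *)
Lemma ex_series_Rpower (sigma : R) :
  (1 < sigma)%R -> ex_series (fun n => / Rpower (INR (S n)) sigma)%R.
Proof.
intros hs.
assert (pos : forall n, (0 < INR (S n))%R) by (intros; apply lt_0_INR; lia).
set (v n := Rpower (INR (S n)) (1 - sigma)).
assert (step : forall n,
  ((sigma - 1) * / Rpower (INR (S (S n))) sigma <= v n - v (S n))%R).
{ intros n.
  set (x := INR (S n)); set (y := INR (S (S n))).
  assert (hx : (0 < x)%R) by apply pos.
  assert (hy : (y = x + 1)%R) by apply S_INR.
  assert (hln : (/ y <= ln y - ln x)%R).
  { assert (e : (1 + (ln x - ln y) <= x / y)%R).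
    { eapply Rle_trans; [apply exp_ineq1_le|].
      unfold Rminus; rewrite exp_plus, exp_Ropp, !exp_ln by lra.
      apply Rle_refl. }
    replace (x / y)%R with (1 - / y)%R in e by (rewrite hy; field; lra).
    lra. }
  assert (hv : v n = (v (S n) * exp ((sigma - 1) * (ln y - ln x)))%R).
  { unfold v, Rpower; rewrite <- exp_plus; f_equal; fold x y; ring. }
  assert (hp : (/ Rpower y sigma = v (S n) * / y)%R).
  { unfold v; fold y; unfold Rminus.
    rewrite Rpower_plus, Rpower_1, Rpower_Ropp by lra.
    field; split; [lra | apply Rgt_not_eq, exp_pos]. }
  rewrite hv, hp.
  assert (hpos : (0 < v (S n))%R) by apply exp_pos.
  pose proof (exp_ineq1_le ((sigma - 1) * (ln y - ln x))).
  assert ((sigma - 1) * / y <= (sigma - 1) * (ln y - ln x))%R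
    by (apply Rmult_le_compat_l; lra).
  nra. }
apply ex_series_incr_1.
apply (ex_finite_lim_seq_incr _ (v 0%nat / (sigma - 1))).
- intros n; rewrite sum_Sn.
  assert (0 < / Rpower (INR (S (S (S n)))) sigma)%R
    by apply Rinv_0_lt_compat, exp_pos.
  unfold plus; simpl; simpl in H; lra.
- intros n.
  assert (bound : ((sigma - 1) *
    sum_n (fun n => / Rpower (INR (S (S n))) sigma) n <= v 0%nat - v (S n))%R).
  { induction n as [|n IH].
    - rewrite sum_O; apply step.
    - rewrite sum_Sn; change (@plus R_AbelianMonoid) with Rplus.
      pose proof (step (S n)).
      rewrite Rmult_plus_distr_l; lra. }
  assert (0 < v (S n))%R by apply exp_pos.
  apply Rmult_le_reg_l with (sigma - 1)%R; [lra|].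
  unfold Rdiv; rewrite (Rmult_comm (v 0%nat)), <- Rmult_assoc, Rinv_r, Rmult_1_l
    by lra.
  apply Rle_trans with (1 := bound); lra.
Qed.

(** * The binomial series *)

Lemma ex_series_ratio (a : nat -> R) (y : R) (N : nat) :
  (0 <= y < 1)%R -> (forall n, 0 <= a n)%R ->
  (forall n, (N <= n)%nat -> a (S n) <= y * a n)%R -> ex_series a.
Proof.
intros hy ha hN.
apply (ex_series_incr_n a N).
apply (ex_series_le (V := R_CompleteNormedModule) _ (fun n => a N * y ^ n)%R).
- intros n; change (Rabs (a (N + n)%nat) <= a N * y ^ n)%R.
  rewrite Rabs_pos_eq by apply ha.
  induction n as [|n IH].
  + rewrite Nat.add_0_r; simpl; lra.
  + rewrite Nat.add_succ_r.
    eapply Rle_trans; [apply hN; lia|].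
    simpl; replace (a N * (y * y ^ n))%R with (y * (a N * y ^ n))%R by ring.
    apply Rmult_le_compat_l; [apply hy | exact IH].
- apply (ex_series_scal_l (V := R_NormedModule) (a N)), ex_series_geom.
  rewrite Rabs_pos_eq; apply hy.
Qed.

Lemma RtoC_nonzero (x : R) : x <> 0%R -> RtoC x <> 0.
Proof. intros hx e; now apply hx, RtoC_inj. Qed.

Lemma P_0 (s : C) : P 0 s = 1.
Proof. unfold P; simpl; field; apply RtoC_nonzero; lra. Qed.

Lemma RtoC_INR_S_nonzero (m : nat) : RtoC (INR (S m)) <> 0.
Proof. apply RtoC_nonzero, not_0_INR; lia. Qed.

(** The ratio of consecutive coefficients gives both the radius of convergence
    of the binomial series and the differential equation of its sum. *)
Lemma P_succ (s : C) (m : nat) :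
  RtoC (INR (S m)) * P (S m) s = (s + RtoC (INR m)) * P m s.
Proof.
unfold P; cbn [rising].
rewrite fact_simpl, mult_INR, RtoC_mult.
field; split; [|apply RtoC_INR_S_nonzero].
apply RtoC_nonzero, INR_fact_neq_0.
Qed.

(** The ratio of consecutive terms is at most
    [(Cmod s + m) * x / (m + 1)], which tends to [x]; from some rank on it stays
    below the midpoint [y] of [x] and [1]. *)
Lemma ex_series_Cmod_P (s : C) (x : R) :
  (0 <= x < 1)%R -> ex_series (fun m => Cmod (P m s) * x ^ m)%R.
Proof.
intros hx.
set (y := ((1 + x) / 2)%R).
(* Past this rank [(Cmod s + n) * x <= y * (n + 1)]. *)
destruct (INR_unbounded (Cmod s * x / (y - x))) as [N hN].
apply ex_series_ratio with y N.
- unfold y; lra.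
- intros n; apply Rmult_le_pos; [apply Cmod_ge_0 | apply pow_le, hx].
- intros n hn.
  apply le_INR in hn.
  assert (hP : (INR (S n) * Cmod (P (S n) s)
                <= (Cmod s + INR n) * Cmod (P n s))%R).
  { rewrite <- (Rabs_pos_eq (INR (S n))), <- Cmod_R, <- Cmod_mult, P_succ,
      Cmod_mult by apply pos_INR.
    apply Rmult_le_compat_r; [apply Cmod_ge_0|].
    eapply Rle_trans; [apply Cmod_triangle|].
    rewrite Cmod_R, Rabs_pos_eq by apply pos_INR; lra. }
  assert (hr : ((Cmod s + INR n) * x <= y * INR (S n))%R).
  { rewrite S_INR.
    assert (Cmod s * x <= INR n * (y - x))%R.
    { apply Rmult_le_reg_r with (/ (y - x))%R.
      - apply Rinv_0_lt_compat; unfold y; lra.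
      - unfold Rdiv in hN; rewrite (Rmult_assoc (INR n)), Rinv_r by (unfold y; lra).
        lra. }
    unfold y in *; lra. }
  apply Rmult_le_reg_l with (INR (S n)); [apply lt_0_INR; lia|].
  assert (h0 : (0 <= Cmod (P n s) * x ^ n)%R)
    by (apply Rmult_le_pos; [apply Cmod_ge_0 | apply pow_le, hx]).
  apply Rle_trans with ((Cmod s + INR n) * Cmod (P n s) * x ^ S n)%R.
  + rewrite <- Rmult_assoc; apply Rmult_le_compat_r; [|exact hP].
    apply pow_le, hx.
  + replace ((Cmod s + INR n) * Cmod (P n s) * x ^ S n)%R
      with ((Cmod s + INR n) * x * (Cmod (P n s) * x ^ n))%R by (simpl; ring).
    replace (INR (S n) * (y * (Cmod (P n s) * x ^ n)))%R
      with (y * INR (S n) * (Cmod (P n s) * x ^ n))%R by ring.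
    apply Rmult_le_compat_r; assumption.
Qed.

Lemma is_series_Re (a : nat -> C) (l : C) :
  is_series a l -> is_series (fun n => Re (a n)) (Re l).
Proof.
intros ha.
apply filterlim_ext with (fun n => Re (sum_n a n)).
- induction x as [|n IH]; [now rewrite !sum_O | now rewrite !sum_Sn, <- IH].
- apply filterlim_comp with (1 := ha).
  apply (continuous_fst (U := R_UniformSpace) (V := R_UniformSpace) (fst l) (snd l)).
Qed.

Lemma is_series_Im (a : nat -> C) (l : C) :
  is_series a l -> is_series (fun n => Im (a n)) (Im l).
Proof.
intros ha.
apply filterlim_ext with (fun n => Im (sum_n a n)).
- induction x as [|n IH]; [now rewrite !sum_O | now rewrite !sum_Sn, <- IH].
- apply filterlim_comp with (1 := ha).
  apply (continuous_snd (U := R_UniformSpace) (V := R_UniformSpace) (fst l) (snd l)).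
Qed.

Lemma CV_radius_of_majorant (c : nat -> R) (d : nat -> R) :
  (forall n, Rabs (c n) <= d n)%R ->
  (forall y, 0 <= y < 1 -> ex_series (fun n => d n * y ^ n)%R)%R ->
  forall x, (Rabs x < 1)%R -> Rbar_lt (Rabs x) (CV_radius c).
Proof.
intros hcd hd x hx.
set (y := ((1 + Rabs x) / 2)%R).
pose proof (Rabs_pos x).
apply Rbar_lt_le_trans with y; [simpl; unfold y; lra|].
apply (proj1 (Lub_Rbar_correct (CV_disk c))).
apply (ex_series_le (V := R_CompleteNormedModule) _ (fun n => d n * y ^ n)%R).
- intros n.
  change (Rabs (Rabs (c n * y ^ n)) <= d n * y ^ n)%R.
  rewrite Rabs_Rabsolu, Rabs_mult, (Rabs_pos_eq (y ^ n))
    by (apply pow_le; unfold y; lra).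
  apply Rmult_le_compat_r; [apply pow_le; unfold y; lra | apply hcd].
- apply hd; unfold y; lra.
Qed.

Lemma Rabs_Im_le_Cmod (w : C) : (Rabs (Im w) <= Cmod w)%R.
Proof.
eapply Rle_trans; [apply Rmax_r | apply Rmax_Cmod].
Qed.

(** When [c] and [d] are the real and imaginary parts of [P m s], in either
    order, this is one component of the equation [(1 - x) * F' = s * F] of the
    binomial series [F]: [alpha] is the real part of [s], and [beta] is, up to
    sign, its imaginary part. *)
Lemma PSeries_first_order_recurrence (c d : nat -> R) (alpha beta x : R) :
  (forall n, INR (S n) * c (S n) = alpha * c n + beta * d n + INR n * c n)%R ->
  Rbar_lt (Rabs x) (CV_radius c) -> Rbar_lt (Rabs x) (CV_radius d) ->
  ((1 - x) * PSeries (PS_derive c) x = alpha * PSeries c x + beta * PSeries d x)%R.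
Proof.
intros hrec hc hd.
assert (e : PSeries (PS_derive c) x
  = PSeries (PS_plus (PS_plus (PS_scal alpha c) (PS_scal beta d))
                     (PS_incr_1 (PS_derive c))) x).
{ apply PSeries_ext; intros n.
  unfold PS_derive at 1; rewrite hrec.
  unfold PS_plus, PS_scal, PS_incr_1, PS_derive.
  destruct n; unfold plus, zero, scal; simpl; unfold mult; simpl; ring. }
assert (ex_pseries (PS_scal alpha c) x)
  by (apply ex_pseries_scal; [apply Rmult_comm | now apply CV_radius_inside]).
assert (ex_pseries (PS_scal beta d) x)
  by (apply ex_pseries_scal; [apply Rmult_comm | now apply CV_radius_inside]).
rewrite PSeries_plus, PSeries_plus, !PSeries_scal, PSeries_incr_1 in e; trivial.
- lra.
- now apply ex_pseries_plus.
- now apply ex_pseries_incr_1, ex_pseries_derive.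
Qed.

(** With [F = A + i B] and [s = sigma + i tau], the hypotheses say
    [(1 - t) * F' = s * F]; hence [F * (1 - t) ^ s] has derivative zero. The
    conclusion is the real part of its constancy on the segment from [0] to
    [x]. *)
Lemma binomial_ode_invariant (sigma tau x : R) (A B A' B' : R -> R) :
  (0 <= x < 1)%R ->
  (forall t, 0 <= t <= x -> is_derive A t (A' t))%R ->
  (forall t, 0 <= t <= x -> is_derive B t (B' t))%R ->
  (forall t, 0 <= t <= x -> (1 - t) * A' t = sigma * A t - tau * B t)%R ->
  (forall t, 0 <= t <= x -> (1 - t) * B' t = sigma * B t + tau * A t)%R ->
  (exp (sigma * ln (1 - x)) * (A x * cos (tau * ln (1 - x))
     - B x * sin (tau * ln (1 - x))) = A 0)%R.
Proof.
intros hx dA dB odeA odeB.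
set (G t := (exp (sigma * ln (1 - t)) * (A t * cos (tau * ln (1 - t))
               - B t * sin (tau * ln (1 - t))))%R).
assert (G0 : G 0%R = A 0%R).
{ unfold G; rewrite Rminus_0_r, ln_1, !Rmult_0_r, exp_0, cos_0, sin_0; ring. }
assert (dG : forall t, (0 <= t <= x)%R -> is_derive G t 0%R).
{ intros t ht; unfold G; auto_derive.
  - repeat split; try lra; eexists; [now apply dA | now apply dB].
  - change (Derive (fun u => A u) t) with (Derive A t).
    change (Derive (fun u => B u) t) with (Derive B t).
    rewrite (is_derive_unique _ _ _ (dA t ht)), (is_derive_unique _ _ _ (dB t ht)).
    replace (A' t) with ((sigma * A t - tau * B t) / (1 - t))%R
      by (rewrite <- odeA by assumption; field; lra).
    replace (B' t) with ((sigma * B t + tau * A t) / (1 - t))%R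
      by (rewrite <- odeB by assumption; field; lra).
    field; lra. }
change (G x = A 0%R); rewrite <- G0.
destruct (proj1 hx) as [h|<-]; [|reflexivity].
symmetry; now apply eq_is_derive.
Qed.

(** The binomial theorem [(1 - x) ^ (- s) = sum P_m(s) x ^ m] for complex [s]:
    the sum satisfies the first-order equation of [(1 - x) ^ (- s)] and takes
    the value [1] at [0]. *)
Lemma is_series_binomial (s : C) (x : R) :
  (0 <= x < 1)%R ->
  is_series (fun m => P m s * RtoC x ^ m) (/ Rcpow (1 - x) s).
Proof.
intros hx.
set (a n := Re (P n s)); set (b n := Im (P n s)).
assert (ra : forall t, (Rabs t < 1)%R -> Rbar_lt (Rabs t) (CV_radius a)).
{ apply CV_radius_of_majorant with (fun n => Cmod (P n s)).
  - intros n; apply re_le_Cmod.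
  - intros y; apply ex_series_Cmod_P. }
assert (rb : forall t, (Rabs t < 1)%R -> Rbar_lt (Rabs t) (CV_radius b)).
{ apply CV_radius_of_majorant with (fun n => Cmod (P n s)).
  - intros n; apply Rabs_Im_le_Cmod.
  - intros y; apply ex_series_Cmod_P. }
set (A := PSeries a); set (B := PSeries b).
set (A' := PSeries (PS_derive a)); set (B' := PSeries (PS_derive b)).
assert (odeA : forall t, (Rabs t < 1)%R ->
  ((1 - t) * A' t = Re s * A t + - Im s * B t)%R).
{ intros t ht; apply PSeries_first_order_recurrence; [|now apply ra|now apply rb].
  intros n; generalize (f_equal Re (P_succ s n)).
  unfold a, b, Re, Im; simpl; lra. }
assert (odeB : forall t, (Rabs t < 1)%R ->
  ((1 - t) * B' t = Re s * B t + Im s * A t)%R).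
{ intros t ht; apply PSeries_first_order_recurrence; [|now apply rb|now apply ra].
  intros n; generalize (f_equal Im (P_succ s n)).
  unfold a, b, Re, Im; simpl; lra. }
assert (dA : forall t, (Rabs t < 1)%R -> is_derive A t (A' t))
  by (intros t ht; apply is_derive_PSeries, ra, ht).
assert (dB : forall t, (Rabs t < 1)%R -> is_derive B t (B' t))
  by (intros t ht; apply is_derive_PSeries, rb, ht).
assert (A0 : A 0%R = 1%R) by (unfold A; rewrite PSeries_0; unfold a; now rewrite P_0).
assert (B0 : B 0%R = 0%R) by (unfold B; rewrite PSeries_0; unfold b; now rewrite P_0).
assert (small : forall t, (0 <= t <= x)%R -> (Rabs t < 1)%R)
  by (intros t ht; rewrite Rabs_pos_eq; lra).
assert (Gx : (exp (Re s * ln (1 - x)) * (A x * cos (Im s * ln (1 - x))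
                - B x * sin (Im s * ln (1 - x))) = 1)%R).
{ transitivity (A 0%R); [|exact A0].
  apply binomial_ode_invariant with A' B'; auto.
  intros t ht; rewrite odeA by auto; ring. }
(* The imaginary part is the same invariant for - i (A + i B) = B - i A. *)
assert (Hx : (exp (Re s * ln (1 - x)) * (B x * cos (Im s * ln (1 - x))
                - - A x * sin (Im s * ln (1 - x))) = 0)%R).
{ transitivity (B 0%R); [|exact B0].
  apply (binomial_ode_invariant (Re s) (Im s) x B (fun t => - A t)%R B'
           (fun t => - A' t)%R); auto.
  - intros t ht; apply (is_derive_opp (V := R_NormedModule)); auto.
  - intros t ht; rewrite odeB by auto; ring.
  - intros t ht; rewrite Ropp_mult_distr_r_reverse, odeA by auto; ring. }
assert (ex : exists l : C, is_series (fun m => P m s * RtoC x ^ m) l).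
{ apply (ex_series_le (V := C_CompleteNormedModule)) with (fun m => Cmod (P m s) * x ^ m)%R;
    [|now apply ex_series_Cmod_P].
  intros n; change (Cmod (P n s * RtoC x ^ n) <= Cmod (P n s) * x ^ n)%R.
  rewrite Cmod_mult, Cmod_pow, Cmod_R, Rabs_pos_eq
    by apply hx.
  apply Rle_refl. }
destruct ex as [l hl].
assert (lA : A x = Re l).
{ apply is_series_unique.
  apply is_series_ext with (2 := is_series_Re _ _ hl).
  intros n; unfold a; rewrite <- RtoC_pow; unfold Re; simpl; ring. }
assert (lB : B x = Im l).
{ apply is_series_unique.
  apply is_series_ext with (2 := is_series_Im _ _ hl).
  intros n; unfold b; rewrite <- RtoC_pow; unfold Im; simpl; ring. }
replace (/ Rcpow (1 - x) s) with l; [exact hl|].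
assert (e : l * Rcpow (1 - x) s = 1).
{ unfold Rcpow, Cexp.
  replace (Re (RtoC (ln (1 - x)) * s)) with (Re s * ln (1 - x))%R
    by (unfold Re; simpl; ring).
  replace (Im (RtoC (ln (1 - x)) * s)) with (Im s * ln (1 - x))%R
    by (unfold Im; simpl; ring).
  rewrite lA, lB in Gx, Hx; unfold Re, Im in Gx, Hx.
  apply injective_projections; unfold Re, Im; simpl; lra. }
rewrite <- (Cmult_1_l (/ _)), <- e; field; apply Rcpow_nonzero.
Qed.

(** * Roots of unity *)

Lemma primitive_root_nonzero (q : nat) (z : C) : primitive_root q z -> z <> 0.
Proof.
intros [hq [hz _]] e; rewrite e in hz.
destruct q as [|q]; [lia|].
rewrite Cpow_S, Cmult_0_l in hz; now apply C1_nz.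
Qed.

Lemma Cmod_primitive_root (q : nat) (z : C) : primitive_root q z -> Cmod z = 1%R.
Proof.
intros [hq [hz _]].
apply (f_equal Cmod) in hz; rewrite Cmod_pow, Cmod_1 in hz.
destruct (pow_R1 _ _ hz) as [h|h]; [|lia].
rewrite Rabs_pos_eq in h; [exact h | apply Cmod_ge_0].
Qed.

Lemma geometric_sum (w : C) (n : nat) :
  (w - 1) * sum_n_m (G := C_AbelianMonoid) (fun h => w ^ h) 1 n = w ^ S n - w.
Proof.
induction n as [|n IH].
- rewrite sum_n_m_zero by lia; change (@zero C_AbelianMonoid) with (RtoC 0).
  rewrite Cpow_S; simpl; ring.
- rewrite sum_n_Sm by lia; change (@plus C_AbelianMonoid) with Cplus.
  rewrite Cmult_plus_distr_l, IH, !Cpow_S; ring.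
Qed.

(** Since [k - 1] is a multiple of [q], the sum runs over full periods of
    [h |-> z ^ (- h)]. It vanishes unless [z = 1], that is [q = 1], when it is
    [k - 1]. *)
Lemma one_plus_sum_inv_pow (q b k : nat) (z : C) :
  primitive_root q z -> k = (b * q + 1)%nat ->
  1 + sum_n_m (G := C_AbelianMonoid) (fun h => / (z ^ h)) 1 (k - 1)
  = RtoC (INR k) ^ delta q.
Proof.
intros hz hk.
pose proof (primitive_root_nonzero q z hz) as hz0.
destruct hz as [hq [hzq hprim]].
replace (k - 1)%nat with (b * q)%nat by lia.
assert (hcase : (q = 1 \/ 2 <= q)%nat) by lia.
destruct hcase as [h1|h2].
- subst q; rewrite Cpow_1_r in hzq; subst z.
  unfold delta; simpl Nat.div; rewrite Cpow_1_r, Nat.mul_1_r.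
  subst k; rewrite Nat.mul_1_r, Nat.add_1_r.
  clear; induction b as [|b IH].
  + rewrite sum_n_m_zero by lia; change (@zero C_AbelianMonoid) with (RtoC 0).
    simpl; ring.
  + rewrite sum_n_Sm by lia; change (@plus C_AbelianMonoid) with Cplus.
    rewrite Cplus_assoc, IH, (S_INR (S b)), RtoC_plus, Cpow_1_l.
    field; apply C1_nz.
- unfold delta; rewrite Nat.div_small by lia.
  assert (hw : / z - 1 <> 0).
  { intros e; apply (hprim 1%nat); [lia|]; rewrite Cpow_1_r.
    symmetry; transitivity (z * (/ z - 1) + z); [field; assumption|].
    rewrite e; ring. }
  rewrite (sum_n_m_ext (G := C_AbelianMonoid) _ (fun h => (/ z) ^ h))
    by (intros h; symmetry; now apply Cpow_inv).
  assert (hs : @eq C (sum_n_m (G := C_AbelianMonoid) (fun h => (/ z) ^ h) 1 (b * q)) 0).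
  { pose proof (geometric_sum (/ z) (b * q)) as hg.
    rewrite Cpow_S, Nat.mul_comm, Cpow_mult_r, (Cpow_inv _ q), hzq in hg
      by assumption.
    rewrite Nat.mul_comm.
    replace (/ 1) with (RtoC 1) in hg by (field; apply C1_nz).
    rewrite Cpow_1_l in hg.
    rewrite <- (Cmult_1_l (sum_n_m _ _ _)), <- (Cinv_l _ hw), <- Cmult_assoc, hg.
    ring. }
  rewrite hs; simpl; ring.
Qed.

(** * The Dirichlet series of the polylogarithm *)

Lemma Cmod_Li_term (z s : C) (n : nat) :
  Cmod z = 1%R ->
  Cmod (z ^ S n / Rcpow (INR (S n)) s) = (/ Rpower (INR (S n)) (Re s))%R.
Proof.
intros hz.
rewrite Cmod_div by apply Rcpow_nonzero.
rewrite Cmod_pow, hz, pow1, Cmod_Rcpow; unfold Rdiv; ring.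
Qed.

Lemma is_series_Li (z s : C) :
  Cmod z = 1%R -> (1 < Re s)%R ->
  is_series (fun n => z ^ S n / Rcpow (INR (S n)) s) (Li z s).
Proof.
intros hz hs.
assert (ex : exists l : C,
  is_series (fun n : nat => z ^ S n / Rcpow (INR (S n)) s) l).
{ apply (ex_series_le (V := C_CompleteNormedModule)) with
    (fun n => / Rpower (INR (S n)) (Re s))%R; [|now apply ex_series_Rpower].
  intros n; change (Cmod (z ^ S n / Rcpow (INR (S n)) s)
                    <= / Rpower (INR (S n)) (Re s))%R.
  rewrite Cmod_Li_term by assumption; apply Rle_refl. }
destruct ex as [l hl].
unfold Li; now rewrite (CSeries_unique _ l hl).
Qed.

(** * Expansion around the multiples of k *)

(** The binomial theorem at [h / n], multiplied by [n ^ (- s)]; the term of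
    index [0] is moved to the other side. *)
Lemma is_series_expansion (s : C) (n h : R) :
  (0 < n)%R -> (0 <= h < n)%R ->
  is_series (fun m => P (S m) s * RtoC h ^ S m / Rcpow n (s + RtoC (INR (S m))))
    (/ Rcpow (n - h) s - / Rcpow n s).
Proof.
intros hn hh.
set (x := (h / n)%R).
assert (hx : (0 <= x < 1)%R).
{ unfold x; split.
  - apply Rmult_le_pos; [apply hh | left; now apply Rinv_0_lt_compat].
  - apply Rmult_lt_reg_r with n; [assumption|].
    unfold Rdiv; rewrite Rmult_assoc, Rinv_l; lra. }
assert (e : Rcpow (n - h) s = Rcpow n s * Rcpow (1 - x) s).
{ rewrite <- Rcpow_mult_base by lra; f_equal; unfold x; field; lra. }
pose proof (is_series_scal_l (/ Rcpow n s) _ _ (is_series_binomial s x hx)) as hb.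
apply is_series_ext with
  (fun m => scal (/ Rcpow n s) (P (S m) s * RtoC x ^ S m)).
{ intros m; change (/ Rcpow n s * (P (S m) s * RtoC x ^ S m)
    = P (S m) s * RtoC h ^ S m / Rcpow n (s + RtoC (INR (S m)))).
  rewrite Rcpow_plus, Rcpow_INR by assumption.
  unfold x; rewrite RtoC_div by lra.
  unfold Cdiv; rewrite Cpow_mult_l, Cpow_inv by (apply RtoC_nonzero; lra).
  field.
  split; [apply Cpow_nz, RtoC_nonzero; lra | apply Rcpow_nonzero]. }
apply (is_series_incr_1 (fun m => scal (/ Rcpow n s) (P m s * RtoC x ^ m))).
refine (eq_ind_r (is_series _) hb _).
rewrite P_0; simpl Cpow.
change (/ Rcpow (n - h) s - / Rcpow n s + / Rcpow n s * (1 * 1)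
        = / Rcpow n s * / Rcpow (1 - x) s).
rewrite e; field; split; apply Rcpow_nonzero.
Qed.

Definition coef (s z : C) (k m : nat) : C :=
  P m s / Rcpow (INR k) (s + RtoC (INR m))
  * @sum_n_m C_AbelianMonoid
      (fun h : nat => / (z ^ h) * RtoC (INR h) ^ m) 1 (k - 1).

(** The factor [k ^ (- m)] cancels the growth of [h ^ m], as [h < k]: the terms
    are dominated by finitely many binomial series at the points [h / k]. *)
Lemma ex_series_Cmod_coef (s z : C) (k : nat) :
  (0 <= Re s)%R -> (1 <= k)%nat -> Cmod z = 1%R ->
  ex_series (fun m => Cmod (coef s z k (S m))).
Proof.
intros hs hk hz.
assert (hk1 : (1 <= INR k)%R) by (apply (le_INR 1); lia).
apply (ex_series_le (V := R_CompleteNormedModule)) with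
  (fun m => sum_n_m (fun h => Cmod (P (S m) s) * (INR h / INR k) ^ S m) 1 (k - 1))%R.
- intros m.
  change (Rabs (Cmod (coef s z k (S m))) <=
    sum_n_m (fun h => Cmod (P (S m) s) * (INR h / INR k) ^ S m) 1 (k - 1))%R.
  rewrite Rabs_pos_eq by apply Cmod_ge_0.
  assert (e : coef s z k (S m) = sum_n_m (G := C_AbelianMonoid)
    (fun h => P (S m) s / Rcpow (INR k) (s + RtoC (INR (S m)))
              * (/ z ^ h * RtoC (INR h) ^ S m)) 1 (k - 1)).
  { symmetry; apply (sum_n_m_mult_l (K := C_Ring)). }
  rewrite e.
  eapply Rle_trans; [apply (norm_sum_n_m (V := C_NormedModule))|].
  apply sum_n_m_le; intros h.
  change (Cmod (P (S m) s / Rcpow (INR k) (s + RtoC (INR (S m)))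
                * (/ z ^ h * RtoC (INR h) ^ S m))
          <= Cmod (P (S m) s) * (INR h / INR k) ^ S m)%R.
  assert (hzh : z ^ h <> 0).
  { apply Cpow_nz; intros h0; rewrite h0, Cmod_0 in hz; lra. }
  rewrite !Cmod_mult, Cmod_div, Cmod_inv, !Cmod_pow, hz, pow1, Cmod_Rcpow, Cmod_R
    by (assumption || apply Rcpow_nonzero).
  rewrite Rabs_pos_eq by apply pos_INR.
  unfold Rdiv; rewrite Rinv_1, Rmult_1_l, Rmult_assoc, Rpow_mult_distr, pow_inv.
  apply Rmult_le_compat_l; [apply Cmod_ge_0|].
  rewrite Rmult_comm; apply Rmult_le_compat_l; [apply pow_le, pos_INR|].
  apply Rinv_le_contravar; [apply pow_lt; lra|].
  rewrite <- Rpower_pow by lra.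
  apply Rle_Rpower; [assumption|].
  rewrite re_plus, re_RtoC; lra.
- eexists.
  apply (is_series_sum_n_m (V := R_NormedModule)
    (fun h m => Cmod (P (S m) s) * (INR h / INR k) ^ S m)%R).
  intros h hh; apply Series_correct.
  apply (ex_series_incr_1 (fun m => Cmod (P m s) * (INR h / INR k) ^ m)%R).
  apply ex_series_Cmod_P.
  assert (INR h < INR k)%R by (apply lt_INR; lia).
  split.
  + apply Rmult_le_pos; [apply pos_INR | left; apply Rinv_0_lt_compat; lra].
  + apply Rmult_lt_reg_r with (INR k); [lra|].
    unfold Rdiv; rewrite Rmult_assoc, Rinv_l; lra.
Qed.

(** Write every positive integer as [k * j - h] with [j >= 1] and
    [0 <= h < k]. As [z ^ k = z], its term in [Li z s] is
    [z ^ j * z ^ (- h) * (k * j - h) ^ (- s)]. The terms [h = 0], which the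
    block sums omit, add up to [k ^ (- s) * Li z s]; for each [h >= 1] the
    subtracted powers [(k * j) ^ (- s)] add up to [z ^ (- h)] times the same
    quantity. In all, [1 + sum z ^ (- h) = k ^ delta q] copies of it are
    missing from [Li z s]. *)
Lemma is_series_Li_residues (s z : C) (q b k : nat) :
  (1 < Re s)%R -> primitive_root q z -> (1 <= k)%nat -> k = (b * q + 1)%nat ->
  is_series
    (fun n => z ^ S n * sum_n_m (G := C_AbelianMonoid)
       (fun h => / (z ^ h) *
          (/ Rcpow (INR k * INR (S n) - INR h) s
           - / Rcpow (INR k * INR (S n)) s)) 1 (k - 1))
    (Li z s * (1 - Rcpow (INR k) (RtoC (INR (delta q)) - s))).
Proof.
intros hs hz hk hkb.
pose proof (primitive_root_nonzero q z hz) as hz0.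
pose proof (Cmod_primitive_root q z hz) as hz1.
assert (hzk : z ^ k = z).
{ destruct hz as [_ [hzq _]].
  rewrite hkb, Nat.mul_comm, Cpow_add_r, Cpow_mult_r, hzq, Cpow_1_l; simpl; ring. }
assert (hkpos : (0 < INR k)%R) by (apply lt_0_INR; lia).
pose proof (one_plus_sum_inv_pow q b k z hz hkb) as hsum.
pose proof (is_series_Li z s hz1 hs) as hLi.
pose proof (is_series_blocks _ (k - 1) _ hLi) as hblock.
pose proof (is_series_scal_l (Rcpow (INR k) (RtoC (INR (delta q)) - s)) _ _ hLi)
  as hLik.
pose proof (is_series_minus _ _ _ _ hblock hLik) as hdiff.
refine (eq_ind _ (is_series _) (is_series_ext _ _ _ _ hdiff) _ _).
- intros n.
  set (N := INR (S n)).
  assert (hN : (0 < N)%R) by (apply lt_0_INR; lia).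
  (* The index of block [n] at distance [h] from its end stands for the integer
     [k * (n + 1) - h]. *)
  assert (hterm : forall h, (h <= k - 1)%nat ->
    z ^ S (n * S (k - 1) + (k - 1 - h))
      / Rcpow (INR (S (n * S (k - 1) + (k - 1 - h)))) s
    = z ^ S n * (/ z ^ h * / Rcpow (INR k * N - INR h) s)).
  { intros h hh.
    assert (hi : (S (n * S (k - 1) + (k - 1 - h)) + h = k * S n)%nat) by nia.
    assert (hR : INR (S (n * S (k - 1) + (k - 1 - h))) = (INR k * N - INR h)%R).
    { unfold N; rewrite <- mult_INR, <- hi, plus_INR; ring. }
    assert (hzp : z ^ S (n * S (k - 1) + (k - 1 - h)) * z ^ h = z ^ S n)
      by (rewrite <- Cpow_add_r, hi, Cpow_mult_r, hzk; reflexivity).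
    rewrite hR, <- hzp; field.
    split; [apply Rcpow_nonzero | now apply Cpow_nz]. }
  set (D0 := / Rcpow (INR k * N) s).
  set (S1 := sum_n_m (G := C_AbelianMonoid)
               (fun h => / z ^ h * / Rcpow (INR k * N - INR h) s) 1 (k - 1)).
  set (S2 := sum_n_m (G := C_AbelianMonoid) (fun h => / z ^ h) 1 (k - 1)).
  assert (hblk : @eq C (sum_n (G := C_AbelianMonoid) (fun h =>
      z ^ S (n * S (k - 1) + (k - 1 - h))
      / Rcpow (INR (S (n * S (k - 1) + (k - 1 - h)))) s) (k - 1))
    (z ^ S n * (D0 + S1))).
  { rewrite (sum_n_ext_loc (G := C_AbelianMonoid) _ _ _ hterm).
    unfold sum_n; rewrite (sum_n_m_mult_l (K := C_Ring)), sum_Sn_m by lia.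
    change (z ^ S n * (/ z ^ 0 * / Rcpow (INR k * N - INR 0) s + S1)
            = z ^ S n * (D0 + S1)).
    unfold D0; simpl (INR 0); rewrite Rminus_0_r; simpl (z ^ 0).
    f_equal; f_equal; field; apply Rcpow_nonzero. }
  assert (hexp : @eq C (sum_n_m (G := C_AbelianMonoid) (fun h => / z ^ h *
      (/ Rcpow (INR k * N - INR h) s - D0)) 1 (k - 1)) (S1 - D0 * S2)).
  { rewrite (sum_n_m_ext (G := C_AbelianMonoid) _
      (fun h => plus (/ z ^ h * / Rcpow (INR k * N - INR h) s)
                     (mult (- D0 : C_Ring) (/ z ^ h)))).
    - rewrite sum_n_m_plus; fold S1.
      rewrite (sum_n_m_mult_l (K := C_Ring)); fold S2.
      change (S1 + (- D0) * S2 = S1 - D0 * S2); ring.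
    - intros h; change (/ z ^ h * (/ Rcpow (INR k * N - INR h) s - D0)
        = / z ^ h * / Rcpow (INR k * N - INR h) s + - D0 * / z ^ h); ring. }
  rewrite hexp.
  fold S2 in hsum.
  change (sum_n (G := C_AbelianMonoid) (fun h =>
      z ^ S (n * S (k - 1) + (k - 1 - h))
      / Rcpow (INR (S (n * S (k - 1) + (k - 1 - h)))) s) (k - 1)
    + - (Rcpow (INR k) (RtoC (INR (delta q)) - s) * (z ^ S n / Rcpow N s))
    = z ^ S n * (S1 - D0 * S2)).
  rewrite hblk, Rcpow_minus, Rcpow_INR, <- hsum by assumption.
  unfold D0; rewrite Rcpow_mult_base by assumption.
  field; split; apply Rcpow_nonzero.
- change (Li z s + - (Rcpow (INR k) (RtoC (INR (delta q)) - s) * Li z s)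
    = Li z s * (1 - Rcpow (INR k) (RtoC (INR (delta q)) - s))).
  ring.
Qed.

Theorem theorem1 (s z : C) (q k b : nat)
    (hs : (1 < Re s)%R)
    (hq : (1 <= q)%nat)
    (hz : primitive_root q z)
    (hk : (2 <= k)%nat)
    (hb : (1 <= b)%nat)
    (hkb : k = (b * q + 1)%nat) :
  is_series
    (fun n : nat =>
       let m := S n in
       P m s * Li z (s + RtoC (INR m)) / Rcpow (INR k) (s + RtoC (INR m))
       * @sum_n_m C_AbelianMonoid
           (fun h : nat => / (z ^ h) * RtoC (INR h) ^ m) 1 (k - 1))
    (Li z s * (1 - Rcpow (INR k) (RtoC (INR (delta q)) - s))).
Proof.
pose proof (Cmod_primitive_root q z hz) as hz1.
assert (hkpos : (0 < INR k)%R) by (apply lt_0_INR; lia).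
assert (pos : forall n, (1 <= INR (S n))%R) by (intros; apply (le_INR 1); lia).
refine (is_series_exchange
  (fun j m => coef s z k (S m) * (z ^ S j / Rcpow (INR (S j)) (s + RtoC (INR (S m)))))
  (fun j => / Rpower (INR (S j)) (Re s))%R (fun m => Cmod (coef s z k (S m)))
  _ _ _ _ (ex_series_Rpower _ hs) _ _ _
  (is_series_Li_residues s z q b k hs hz _ hkb)).
- intros j m.
  change (Cmod (coef s z k (S m)
                * (z ^ S j / Rcpow (INR (S j)) (s + RtoC (INR (S m)))))
          <= / Rpower (INR (S j)) (Re s) * Cmod (coef s z k (S m)))%R.
  rewrite Cmod_mult, Cmod_Li_term, Rmult_comm by assumption.
  apply Rmult_le_compat_r; [apply Cmod_ge_0|].
  apply Rinv_le_contravar; [apply exp_pos|].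
  apply Rle_Rpower; [apply pos|].
  rewrite re_plus, re_RtoC; pose proof (pos_INR (S m)); lra.
- apply ex_series_Cmod_coef; [lra | lia | assumption].
- intros j.
  set (N := INR (S j)).
  assert (hN : (1 <= N)%R) by apply pos.
  assert (hterm : forall h, (1 <= h <= k - 1)%nat -> is_series (V := C_NormedModule)
    (fun m => / z ^ h * (P (S m) s * RtoC (INR h) ^ S m
                         / Rcpow (INR k * N) (s + RtoC (INR (S m)))))
    (/ z ^ h * (/ Rcpow (INR k * N - INR h) s - / Rcpow (INR k * N) s))).
  { intros h hh.
    apply (is_series_scal_l (V := C_NormedModule) (/ z ^ h : C_AbsRing)).
    assert (INR h < INR k)%R by (apply lt_INR; lia).
    apply is_series_expansion; [apply Rmult_lt_0_compat; lra|].
    split; [apply pos_INR | nra]. }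
  pose proof (is_series_scal_l (z ^ S j) _ _
    (is_series_sum_n_m (V := C_NormedModule) _ _ _ _ hterm)) as hrow.
  refine (is_series_ext _ _ _ _ hrow).
  intros m.
  set (w := s + RtoC (INR (S m))).
  rewrite (sum_n_m_ext (G := C_AbelianMonoid) _
    (fun h => mult (P (S m) s / Rcpow (INR k * N) w : C_Ring)
                   (/ z ^ h * RtoC (INR h) ^ S m))).
  + rewrite (sum_n_m_mult_l (K := C_Ring)).
    unfold coef; fold w.
    set (S0 := @sum_n_m C_AbelianMonoid (fun h => / z ^ h * RtoC (INR h) ^ S m) 1 (k - 1)).
    change (z ^ S j * (P (S m) s / Rcpow (INR k * N) w * S0)
      = P (S m) s / Rcpow (INR k) w * S0 * (z ^ S j / Rcpow N w)).
    rewrite Rcpow_mult_base by lra.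
    field; split; apply Rcpow_nonzero.
  + intros h.
    change (/ z ^ h * (P (S m) s * RtoC (INR h) ^ S m / Rcpow (INR k * N) w)
      = P (S m) s / Rcpow (INR k * N) w * (/ z ^ h * RtoC (INR h) ^ S m)).
    unfold Cdiv; ring.
- intros m; cbv zeta.
  set (w := s + RtoC (INR (S m))).
  assert (hw : (1 < Re w)%R).
  { unfold w; rewrite re_plus, re_RtoC; pose proof (pos_INR (S m)); lra. }
  pose proof (is_series_scal_l (coef s z k (S m)) _ _ (is_series_Li z w hz1 hw)) as h.
  refine (eq_ind _ (is_series _) h _ _).
  change (coef s z k (S m) * Li z w = P (S m) s * Li z w / Rcpow (INR k) w
    * sum_n_m (G := C_AbelianMonoid) (fun h => / z ^ h * RtoC (INR h) ^ S m) 1 (k - 1)).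
  unfold coef, Cdiv; fold w.
  set (S0 := @sum_n_m C_AbelianMonoid (fun h => / z ^ h * RtoC (INR h) ^ S m) 1 (k - 1)).
  ring.
- lia.
Qed.
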